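(* Let $t\in\mathbb{Z}^{+}$ and let $K^{r}_{n_1,n_2,\ldots,n_t}$ be a complete $t$-partite $r$-uniform hypergraph with partite sets $N_1,\ldots,N_t$. For each $i$ let $v_i\in N_i$, and let $S=\bigcup_{i=1}^{t}(N_i-\{v_i\})$. Then $S$ is a locating-dominating set for $K^{r}_{n_1,n_2,\ldots,n_t}$ if and only if there is at most one partite set of cardinality $1$.
   Context: A hypergraph $H$ is a pair $(V(H),E(H))$ with $V(H)$ a finite set and $E(H)$ a finite family of non-empty subsets of $V(H)$ (hyperedges) whose union is $V(H)$. Standing assumption: all hypergraphs are connected (any two vertices are joined by a path $v,E_1,w_1,E_2,\ldots,w_{l-1},E_l,u$ with $v\in E_1$, $w_i\in E_i\cap E_{i+1}$, $u\in E_l$) and Sperner (no hyperedge is a subset of another hyperedge). Let $N_1,\ldots,N_t$ be disjoint finite sets with $|N_i|=n_i$. The complete $t$-partite $r$-uniform hypergraph $K^{r}_{n_1,\ldots,n_t}$ has vertex set $\bigcup_{i=1}^t N_i$, and its hyperedges are exactly the subsets $E$ of the vertex set with $|E|=r$ and $|E\cap N_i|\le 1$ for all $i$; the $N_i$ are its partite sets. For a vertex $u$, $N(u)$ is the set of vertices $v\ne u$ such that some hyperedge contains both $u$ and $v$. A set $S\subseteq V(H)$ is locating-dominating if for any two distinct $u,v\in V(H)-S$, $N(u)\cap S\neq N(v)\cap S$, and $N(u)\cap S\ne\emptyset$ for every $u\in V(H)-S$.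
   Formalization: Assumes in addition that if t ≤ 2 then the number of partite sets of cardinality 1 is not exactly one; this excludes only the one-vertex hypergraph and the stars K^2_{1,m}, m > 1, where S is not dominating and the claim fails. *)

(* Defs.v *)
From HB Require Import structures.
From mathcomp Require Import all_boot.

Set Implicit Arguments.
Unset Strict Implicit.
Unset Printing Implicit Defensive.

Record hypergraph (T : finType) := Hypergraph {
  vertices : {set T};
  edges : {set {set T}};
  edges_nonempty : set0 \notin edges;
  cover_edges : cover edges = vertices
}.

Section HypergraphNotions.

Variables (T : finType) (H : hypergraph T).

Definition share_edge : rel T :=
  [rel u v | [exists E in edges H, (u \in E) && (v \in E)]].

(* A hypergraph path v, E_1, w_1, ..., E_l, u is a [path share_edge] with the
   hyperedges E_i left existentially quantified; the trivial path, which
   [connect] also allows, only joins a vertex to itself. *)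
Definition connected : Prop :=
  {in vertices H &, forall u v, connect share_edge u v}.

Definition sperner : Prop :=
  {in edges H &, forall E F : {set T}, E \subset F -> E = F}.

Definition neighbors (u : T) : {set T} :=
  [set v in vertices H | (v != u) && share_edge u v].

Definition locating_dominating (S : {set T}) : Prop :=
  [/\ S \subset vertices H,
      {in vertices H :\: S &, forall u v, u != v ->
         neighbors u :&: S <> neighbors v :&: S}
    & {in vertices H :\: S, forall u, neighbors u :&: S <> set0}].

(* [H] is K^r_(n_1,...,n_t), with partite sets [N i] of size n_i = #|N i|. *)
Definition complete_multipartite (r t : nat) (N : 'I_t -> {set T}) : Prop :=
  [/\ forall i j, i != j -> [disjoint N i & N j],
      vertices H = \bigcup_(i < t) N i
    & edges H = [set E : {set T} | [&& E \subset \bigcup_(i < t) N i,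
                   #|E| == r & [forall i, #|E :&: N i| <= 1]]]].

End HypergraphNotions.

(* Main.v *)
Require Import Defs.
From mathcomp Require Import all_boot.

Set Implicit Arguments.
Unset Strict Implicit.
Unset Printing Implicit Defensive.

(** Every pair of vertices in different partite sets lies on a common hyperedge
    as soon as [1 < r], while no hyperedge meets a partite set twice.  Hence a
    vertex of [N i] has all of [vertices H :\: N i] as neighbourhood
    ([neighbors_multipartite]).  The vertices outside [S] are exactly the [v i],
    and the trace of the neighbourhood of [v i] on [S] is [S :\: N i]
    ([neighbors_trace]).  So the trace of [v i] misses exactly the
    [#|N i| - 1] vertices of [S] lying in [N i]: two singleton parts give the
    same trace [S], so [S] does not locate them, whereas a part with two elements separates its own
    representative from every other one.  With at most one singleton part the
    traces are therefore pairwise distinct, and they are nonempty as soon as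
    every [i] has a companion [j != i] with [1 < #|N j|]; for [t = 2] this is
    what the nondegeneracy hypothesis provides.

    The inequality [1 < r] comes from connectedness: hyperedges of size one join
    no two vertices, so [H] would be a single vertex, which is degenerate. *)

(** * Subsets and transversals *)

Lemma exists_subset_card (I : finType) (A : {set I}) (n : nat) :
  #|A| <= n <= #|I| -> exists B : {set I}, A \subset B /\ #|B| = n.
Proof.
case/andP=> leAn lenI.
have: n - #|A| <= #|~: A| by rewrite leq_subLR cardsC.
case/card_geqP=> s [s_uniq s_size s_sub].
exists (A :|: [set:: s]); split; first exact: subsetUl.
rewrite cardsU (_ : A :&: [set:: s] = set0) ?cards0 ?subn0.
  by rewrite cardsE (card_uniqP s_uniq) s_size subnKC.
apply/setP=> x; rewrite !inE; apply/andP=> -[xA /s_sub].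
by rewrite inE xA.
Qed.

Lemma part_unique (T I : finType) (N : I -> {set T}) (x : T) (i j : I) :
  (forall k l, k != l -> [disjoint N k & N l]) ->
  x \in N i -> x \in N j -> i = j.
Proof.
move=> disjN xi xj; apply/eqP; apply: contraTT xj => /disjN dij.
by rewrite (disjointFr dij xi).
Qed.

Lemma transversal_card (T I : finType) (N : I -> {set T}) (E : {set T}) :
  E \subset \bigcup_i N i -> (forall i, #|E :&: N i| <= 1) -> #|E| <= #|I|.
Proof.
move=> /setIidPl subE E1; rewrite -subE big_distrr /=.
apply: (@leq_trans (\sum_(i : I) #|E :&: N i|)).
  elim/big_rec2: _ => [|i n A _ leAn]; first by rewrite cards0.
  by rewrite cardsU (leq_trans (leq_subr _ _)) // leq_add2l.
by rewrite -sum1_card leq_sum // => i _; apply: E1.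
Qed.

(** Changing a system of representatives [v] in the two coordinates [i] and [j]
    gives a transversal through prescribed points [x] and [y]; restricting it
    to [r] coordinates, [i] and [j] among them, gives the required set. *)
Lemma transversal_through (T I : finType) (N : I -> {set T}) (v : I -> T)
    (r : nat) (i j : I) (x y : T) :
  (forall k l, k != l -> [disjoint N k & N l]) -> (forall k, v k \in N k) ->
  1 < r <= #|I| -> i != j -> x \in N i -> y \in N j ->
  exists E : {set T}, [/\ E \subset \bigcup_k N k, #|E| = r,
    forall k, #|E :&: N k| <= 1, x \in E & y \in E].
Proof.
move=> disjN v_in /andP[r_gt1 r_le] neq_ij xi yj.
pose w k := if k == i then x else if k == j then y else v k.
have w_in k : w k \in N k.
  by rewrite /w; case: eqP => [->//|_]; case: eqP => [->|].
have w_inj : injective w.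
  move=> k l wkl; apply: (part_unique disjN (w_in k)).
  by rewrite wkl.
have [|K [ijK cardK]] := @exists_subset_card I [set i; j] r.
  by rewrite cards2 neq_ij r_gt1.
exists (w @: K); split.
- by apply/subsetP=> _ /imsetP[k _ ->]; apply/bigcupP; exists k.
- by rewrite card_imset.
- move=> k; apply/card_le1_eqP=> a b.
  rewrite !inE => /andP[/imsetP[l _ ->] lk] /andP[/imsetP[m _ ->] mk].
  by rewrite (part_unique disjN (w_in l) lk) (part_unique disjN (w_in m) mk).
- apply/imsetP; exists i; last by rewrite /w eqxx.
  by rewrite (subsetP ijK) // !inE eqxx.
- apply/imsetP; exists j; last by rewrite /w eq_sym (negPf neq_ij) eqxx.
  by rewrite (subsetP ijK) // !inE eqxx orbT.
Qed.

(** * Complete multipartite hypergraphs *)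

Lemma edge_multipartite (T : finType) (H : hypergraph T) (r t : nat)
    (N : 'I_t -> {set T}) (E : {set T}) :
  complete_multipartite H r N -> E \in edges H ->
  [/\ E \subset \bigcup_(i < t) N i, #|E| = r & forall i, #|E :&: N i| <= 1].
Proof.
by case=> _ _ ->; rewrite inE => /and3P[? /eqP ? /forallP ?].
Qed.

Lemma rank_le_parts (T : finType) (H : hypergraph T) (r t : nat)
    (N : 'I_t -> {set T}) (x : T) :
  complete_multipartite H r N -> x \in vertices H -> r <= t.
Proof.
move=> HN; rewrite -cover_edges => /bigcupP[E EH _].
have [subE <- E1] := edge_multipartite HN EH.
by rewrite -[X in _ <= X]card_ord; apply: transversal_card subE E1.
Qed.

(** Hyperedges of size at most one never join distinct vertices, so a connected
    hypergraph with such hyperedges has a single vertex. *)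
Lemma connected_rank_gt1 (T : finType) (H : hypergraph T) (r : nat) (x y : T) :
  connected H -> {in edges H, forall E : {set T}, #|E| = r} ->
  x \in vertices H -> y \in vertices H -> x != y -> 1 < r.
Proof.
move=> Hconn cardE xH yH; apply: contraNT; rewrite -leqNgt => r_le1.
have /connectP[p] := Hconn x y xH yH.
elim: p x {xH} => [|z p IHp] x /=; first by move=> _ ->.
case/andP=> /existsP[E /and3P[EH xE zE]] pz lastz.
suff -> : x = z by apply: IHp.
by have /card_le1_eqP/(_ x z xE zE) : #|E| <= 1 by rewrite cardE.
Qed.

Lemma neighbors_multipartite (T : finType) (H : hypergraph T) (r t : nat)
    (N : 'I_t -> {set T}) (v : 'I_t -> T) (i : 'I_t) (x : T) :
  complete_multipartite H r N -> (forall k, v k \in N k) -> 1 < r ->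
  x \in N i -> neighbors H x = vertices H :\: N i.
Proof.
move=> HN v_in r_gt1 xi; have [disjN VH EH] := HN.
apply/setP=> y; rewrite !inE [RHS]andbC; case yH: (y \in vertices H) => //=.
apply/andP/idP=> [[neq_yx /existsP[E /and3P[/(edge_multipartite HN)]]]|yNi].
  case=> _ _ /(_ i)/card_le1_eqP E1 xE yE; apply: contra neq_yx => yi.
  by apply/eqP/E1; rewrite inE ?xE ?yE.
have r_le := rank_le_parts HN yH.
split; first by apply: contraNneq yNi => ->.
move: yH; rewrite VH => /bigcupP[j _ yj].
have neq_ij : i != j by apply: contraNneq yNi => ->.
have [|E [subE cE E1 xE yE]] :=
  @transversal_through T 'I_t N v r i j x y disjN v_in _ neq_ij xi yj.
  by rewrite card_ord r_gt1.
apply/existsP; exists E; rewrite EH inE subE cE eqxx xE yE !andbT /=.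
exact/forallP.
Qed.

Lemma neighbors_trace (T : finType) (H : hypergraph T) (r t : nat)
    (N : 'I_t -> {set T}) (v : 'I_t -> T) (i : 'I_t) (S : {set T}) :
  complete_multipartite H r N -> (forall k, v k \in N k) -> 1 < r ->
  S \subset vertices H -> neighbors H (v i) :&: S = S :\: N i.
Proof.
move=> HN v_in r_gt1 subS.
rewrite (neighbors_multipartite HN v_in r_gt1 (v_in i)).
by rewrite setIC setIDA (setIidPl subS).
Qed.

(** * The set omitting one representative of each part *)

Lemma mem_omit (T I : finType) (N : I -> {set T}) (v : I -> T) (x : T) (i : I) :
  (forall k l, k != l -> [disjoint N k & N l]) -> x \in N i ->
  (x \in \bigcup_k (N k :\ v k)) = (x != v i).
Proof.
move=> disjN xi; apply/bigcupP/idP=> [[k _]|neq_x]; last first.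
  by exists i; rewrite // !inE neq_x.
by rewrite !inE => /andP[neq_x xk]; rewrite (part_unique disjN xi xk).
Qed.

Lemma card_neq1P (T : finType) (A : {set T}) (a : T) :
  a \in A -> reflect (exists2 x, x \in A & x != a) (#|A| != 1).
Proof.
move=> aA; rewrite (cardsD1 a) aA eqSS cards_eq0.
apply: (iffP (set0Pn _)) => [[x]|[x xA neq_x]].
  by rewrite !inE => /andP[]; exists x.
by exists x; rewrite !inE neq_x.
Qed.

(** Applied to [P k := #|N k| == 1], this makes the trace of [v i] nonempty.
    Among three indices one avoids both [i] and the only possible index
    satisfying [P]; for two indices the count of those satisfying [P] is at
    most one and different from one, so [P] never holds. *)
Lemma exists_other_large (t : nat) (P : pred 'I_t) (i : 'I_t) :
  1 < t -> (t <= 2 -> #|[set k | P k]| != 1) -> #|[set k | P k]| <= 1 ->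
  exists2 j, j != i & ~~ P j.
Proof.
move=> t_gt1 nondeg le1; apply/exists_inP; apply: contraT.
move=> /exists_inPn all_P.
have others_P : [set~ i] \subset [set k | P k].
  by apply/subsetP=> j; rewrite !inE => /all_P; rewrite negbK.
have := subset_leq_card others_P; rewrite cardsC1 card_ord => le_t.
have t_le2 : t <= 2.
  by rewrite -(prednK (ltnW t_gt1)) ltnS (leq_trans le_t).
have := nondeg t_le2; rewrite eqn_leq le1 /= -ltnNge ltnS leqn0 => /eqP c0.
by move: le_t t_gt1; rewrite c0; case: (t) => [|[]].
Qed.

Theorem theorem3p13 (T : finType) (H : hypergraph T) (r t : nat)
    (N : 'I_t -> {set T}) (v : 'I_t -> T)
    (t_gt0 : 0 < t)
    (H_connected : connected H)
    (H_sperner : sperner H)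
    (H_complete : complete_multipartite H r N)
    (* excludes exactly the one-vertex hypergraph and the stars K^2_(1,m), m > 1,
       for which the equivalence fails *)
    (H_nondegenerate : t <= 2 -> #|[set i | #|N i| == 1]| != 1)
    (v_in : forall i, v i \in N i) :
  locating_dominating H (\bigcup_(i < t) (N i :\ v i)) <->
    #|[set i | #|N i| == 1]| <= 1.
Proof.
have [disjN VH EH] := H_complete.
have N_sub i x : x \in N i -> x \in vertices H.
  by rewrite VH => xi; apply/bigcupP; exists i.
have vH i := N_sub i _ (v_in i).
have v_inj : injective v.
  by move=> i j eq_v; apply: (part_unique disjN (v_in i)); rewrite eq_v.
have cardE : {in edges H, forall E : {set T}, #|E| = r}.
  by move=> E /(edge_multipartite H_complete)[].
pose i0 := Ordinal t_gt0.
have r_gt1 : 1 < r.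
  (* A vertex other than [v i0] is needed: a point of another part if there is
     one, and otherwise a second point of [N i0], which is then not a singleton
     by nondegeneracy. *)
  have [t_gt1|t_le1] := ltnP 1 t.
    apply: (connected_rank_gt1 H_connected cardE (vH i0) (vH (Ordinal t_gt1))).
    by rewrite (inj_eq v_inj).
  have : #|N i0| != 1.
    apply: contra (H_nondegenerate (leqW t_le1)) => /eqP N1.
    have all_i0 k : k = i0.
      by apply/val_inj/eqP; rewrite /= -leqn0 -ltnS (leq_trans (ltn_ord k)).
    apply/cards1P; exists i0; apply/setP=> k.
    by rewrite !inE (all_i0 k) N1 !eqxx.
  case/(card_neq1P (v_in i0))=> x xi0.
  exact: (connected_rank_gt1 H_connected cardE (N_sub _ _ xi0) (vH i0)).
have t_gt1 : 1 < t := leq_trans r_gt1 (rank_le_parts H_complete (vH i0)).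
set S := \bigcup_(i < t) _.
have S_sub : S \subset vertices H.
  by apply/bigcupsP=> i _; apply/subsetP=> x; rewrite inE => /andP[_ /N_sub].
have trace i := neighbors_trace i H_complete v_in r_gt1 S_sub.
have v_out i : v i \in vertices H :\: S.
  by rewrite inE vH (mem_omit v disjN (v_in i)) eqxx.
have outP x : x \in vertices H :\: S -> exists i, x = v i.
  rewrite inE {1}VH => /andP[xS /bigcupP[i _ xi]]; exists i; apply/eqP.
  by move: xS; rewrite (mem_omit v disjN xi) negbK.
(* What separates [v i] from [v j]: a second point of [N i] lies in the trace
   of every [v j] with [j != i]. *)
have large_sep i j : i != j -> #|N i| != 1 ->
    exists2 x, x \in S :\: N j & x \in N i.
  move=> neq_ij /(card_neq1P (v_in i))[x xi neq_x]; exists x => //.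
  rewrite inE (mem_omit v disjN xi) neq_x andbT.
  by rewrite (disjointFr (disjN _ _ neq_ij) xi).
split=> [[_ S_loc _]|le1].
  apply/card_le1_eqP=> j i; rewrite !inE => Nj1 Ni1; apply/eqP/negPn/negP.
  move=> neq_ij.
  apply: (S_loc _ _ (v_out i) (v_out j)); first by rewrite (inj_eq v_inj).
  have trace1 k : #|N k| == 1 -> S :\: N k = S.
    move=> Nk1; apply/setDidPl; rewrite -setI_eq0; apply/eqP/setP=> x.
    rewrite !inE; apply/andP=> -[xS xk].
    move: xS; rewrite (mem_omit v disjN xk) => neq_x.
    by case/negP: (introT (card_neq1P (v_in k)) (ex_intro2 _ _ x xk neq_x)).
  by rewrite !trace (trace1 i Ni1) (trace1 j Nj1).
split=> // [x y /outP[i ->] /outP[j ->]|x /outP[i ->]].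
  rewrite (inj_eq v_inj) !trace => neq_ij eq_tr.
  have [Ni1|/(large_sep i j neq_ij)[z]] := boolP (#|N i| == 1); last first.
    by rewrite -eq_tr inE => /andP[/negPf->].
  have Nj1 : #|N j| != 1.
    apply: contra neq_ij => Nj1; apply/eqP.
    by apply: (card_le1_eqP le1); rewrite inE.
  rewrite eq_sym in neq_ij; have [z] := large_sep j i neq_ij Nj1.
  by rewrite eq_tr inE => /andP[/negPf->].
rewrite trace => tr0.
have [j neq_ji Nj] := exists_other_large i t_gt1 H_nondegenerate le1.
by have [z] := large_sep j i neq_ji Nj; rewrite tr0 inE.
Qed.
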